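(* Let $T\ge 1$ and $n\ge 1$ be integers. For each $t\in\{1,\dots,T\}$ let $L_t:\mathbb{R}^n\times\mathbb{R}^n\to\mathbb{R}\cup\{+\infty\}$ be proper, convex and lower semicontinuous, and let $g:\mathbb{R}^n\to\mathbb{R}\cup\{+\infty\}$ be proper, convex and lower semicontinuous. Let $\vartheta_\tau$ be the primal value function, $H_t$ the Hamiltonians, and $f$, $K_t$ the dual data defined in the context. Let $\tau\in\{0,\dots,T-1\}$ and $\xi,\eta\in\mathbb{R}^n$ be given. Suppose that there is a discrete-time Hamiltonian trajectory on $\{\tau,\dots,T\}$, i.e. $\{(x_t,p_t)\}_{t=\tau}^T\subset\mathbb{R}^n\times\mathbb{R}^n$ with $$(-\Delta p_t,\Delta x_t)\in\partial H_t(x_{t-1},p_t)\qquad\text{for all } t\in\{\tau+1,\dots,T\},$$ such that $(x_\tau,p_\tau)=(\xi,-\eta)$ and that satisfies the transversality condition $-p_T\in\partial g(x_T)$. Then $\eta\in\partial\vartheta_\tau(\xi)$. Moreover, the converse holds true (that is, if $\eta\in\partial\vartheta_\tau(\xi)$, then such a trajectory exists) provided both of the following qualification conditions hold: (primal) there exists $\{\bar x_t\}_{t=0}^T\subset\mathbb{R}^n$ with $\bar x_T\in\operatorname{ri}(\operatorname{dom}(g))$ and, for all $t\in\{1,\dots,T\}$, $\bar x_{t-1}\in\operatorname{ri}(\mathbf{X}(t))$ and $\Delta\bar x_t\in\operatorname{ri}(\Gamma_L(t,\bar x_{t-1}))$; (dual) there exists $\{\bar p_t\}_{t=0}^T\subset\mathbb{R}^n$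 with $\bar p_T\in\operatorname{ri}(\operatorname{dom}(f))$ and, for all $t\in\{1,\dots,T\}$, $\bar p_{t-1}\in\operatorname{ri}(\mathbf{P}(t))$ and $\Delta\bar p_t\in\operatorname{ri}(\Gamma_K(t,\bar p_{t-1}))$.
   Context: Notation: for a sequence, $\Delta x_t:=x_t-x_{t-1}$. For an extended-real-valued function $\varphi$, $\operatorname{dom}(\varphi)=\{x:\varphi(x)<+\infty\}$; $\varphi$ is proper if $\operatorname{dom}(\varphi)\ne\emptyset$ and $\varphi>-\infty$ everywhere; $\operatorname{ri}(S)$ is the relative interior of a convex set $S$; the conjugate is $\varphi^*(y)=\sup_x\{x\cdot y-\varphi(x)\}$. For $x\in\operatorname{dom}(\varphi)$, the subdifferential is $\partial\varphi(x)=\{y:\varphi(x)+y\cdot(z-x)\le\varphi(z)\ \forall z\}$. Primal value function: for $\tau\in\{0,\dots,T-1\}$ and $\xi\in\mathbb{R}^n$, $$\vartheta_\tau(\xi):=\inf\Big\{\sum_{t=\tau+1}^T L_t(x_{t-1},\Delta x_t)+g(x_T)\ :\ \{x_t\}_{t=\tau}^T\subset\mathbb{R}^n,\ x_\tau=\xi\Big\}.$$ Dual data: $f(b):=g^*(-b)$ and $K_t(p,w):=\sup_{x,v\in\mathbb{R}^n}\{x\cdot w+v\cdot p-L_t(x,v)\}$. Constraint maps: $\Gamma_L(t,x):=\{v\in\mathbb{R}^n: L_t(x,v)\in\mathbb{R}\}$, $\mathbf{X}(t):=\{x\in\mathbb{R}^n:\Gamma_L(t,x)\neq\emptyset\}$,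 $\Gamma_K(t,p):=\{w\in\mathbb{R}^n: K_t(p+w,w)\in\mathbb{R}\}$, $\mathbf{P}(t):=\{p\in\mathbb{R}^n:\Gamma_K(t,p)\neq\emptyset\}$. Hamiltonian: $H_t(x,p):=\sup_{v\in\mathbb{R}^n}\{p\cdot v-L_t(x,v)\}\in\mathbb{R}\cup\{\pm\infty\}$ for $t\in\{1,\dots,T\}$; it is concave in $x$ and convex in $p$. Its (concave-convex) subdifferential is defined by: $(-w,v)\in\partial H_t(\bar x,\bar p)$ if and only if $$H_t(x,\bar p)+w\cdot(x-\bar x)\le H_t(\bar x,\bar p)\le H_t(\bar x,p)-v\cdot(p-\bar p)\qquad\forall x,p\in\mathbb{R}^n.$$ *)

(* Defs.v *)
From HB Require Import structures.
From mathcomp Require Import all_boot all_order all_algebra.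
From mathcomp Require Import all_classical all_reals all_analysis.

Set Implicit Arguments.
Unset Strict Implicit.
Unset Printing Implicit Defensive.

Import Order.TTheory GRing.Theory Num.Theory.
Import numFieldNormedType.Exports.

Local Open Scope classical_set_scope.
Local Open Scope ring_scope.

Definition dot (R : realType) (n : nat) (x y : 'rV[R]_n) : R :=
  \sum_(i < n) x 0 i * y 0 i.

Section convex_analysis.
Context {R : realType}.
Local Open Scope ereal_scope.

Definition edom (X : Type) (phi : X -> \bar R) : set X :=
  [set x | phi x < +oo].

Definition proper_fun (X : Type) (phi : X -> \bar R) : Prop :=
  edom phi !=set0 /\ forall x, -oo < phi x.

(* The library's [convex_function] is for real-valued functions only.  Since
   [s] stays in the open interval, [s%:E * +oo] is always [+oo] here. *)
Definition convex_efun (E : lmodType R) (phi : E -> \bar R) : Prop :=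
  forall (x y : E) (s : R), (0 < s < 1)%R ->
    phi (s *: x + (1 - s) *: y)%R <= s%:E * phi x + (1 - s)%:E * phi y.

Definition affine_set (E : lmodType R) (M : set E) : Prop :=
  forall (x y : E) (s : R), M x -> M y -> M (s *: x + (1 - s) *: y)%R.

Definition affine_hull (E : lmodType R) (S : set E) : set E :=
  smallest (@affine_set E) S.

Definition rel_interior (n : nat) (S : set 'rV[R]_n) : set 'rV[R]_n :=
  [set x | S x /\ \forall y \near x, affine_hull S y -> S y].

Definition conjugate (n : nat) (phi : 'rV[R]_n -> \bar R) (y : 'rV[R]_n) :
    \bar R :=
  ereal_sup (range (fun x => (dot x y)%:E - phi x)).

(* Empty at points outside the effective domain. *)
Definition subdiff (n : nat) (phi : 'rV[R]_n -> \bar R) (x : 'rV[R]_n) :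
    set 'rV[R]_n :=
  [set y | edom phi x /\ forall z, phi x + (dot y (z - x)%R)%:E <= phi z].

(* Subdifferential of a concave-convex function: its elements are written
   [(- w, v)], so that [w] is the opposite of the first component. *)
Definition cc_subdiff (n : nat) (H : 'rV[R]_n -> 'rV[R]_n -> \bar R)
    (xbar pbar : 'rV[R]_n) : set ('rV[R]_n * 'rV[R]_n) :=
  [set q | let w := (- q.1)%R in let v := q.2 in
    forall x p,
      H x pbar + (dot w (x - xbar)%R)%:E <= H xbar pbar /\
      H xbar pbar <= H xbar p - (dot v (p - pbar)%R)%:E].

End convex_analysis.

(* Sequences indexed by {0, ..., T} or {tau, ..., T} are functions on [nat],
   of which only the values at these indices are used. *)
Definition Delta (V : zmodType) (x : nat -> V) (t : nat) : V := x t - x t.-1.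

Section bolza.
Context {R : realType} {n : nat}.
Local Notation V := 'rV[R]_n.
Variables (T : nat) (L : nat -> V * V -> \bar R) (g : V -> \bar R).
Local Open Scope ereal_scope.

Definition primal_value (tau : nat) (xi : V) : \bar R :=
  ereal_inf [set \sum_(tau.+1 <= t < T.+1) L t (x t.-1, Delta x t) + g (x T)
            | x in [set x : nat -> V | x tau = xi]].

Definition dual_f (b : V) : \bar R := conjugate g (- b)%R.

Definition dual_K (t : nat) (q : V * V) : \bar R :=
  let p := q.1 in let w := q.2 in
  ereal_sup (range (fun z : V * V => let x := z.1 in let v := z.2 in
    (dot x w + dot v p)%:E - L t (x, v))).

Definition Gamma_L (t : nat) (x : V) : set V :=
  [set v | L t (x, v) \is a fin_num].

Definition dom_X (t : nat) : set V := [set x | Gamma_L t x !=set0].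

Definition Gamma_K (t : nat) (p : V) : set V :=
  [set w | dual_K t ((p + w)%R, w) \is a fin_num].

Definition dom_P (t : nat) : set V := [set p | Gamma_K t p !=set0].

Definition hamiltonian (t : nat) (x p : V) : \bar R :=
  ereal_sup (range (fun v => (dot p v)%:E - L t (x, v))).

Definition hamiltonian_trajectory (tau : nat) (x p : nat -> V) : Prop :=
  forall t, (tau < t <= T)%N ->
    cc_subdiff (hamiltonian t) (x t.-1) (p t) ((- Delta p t)%R, Delta x t).

Definition transversal_trajectory_exists (tau : nat) (xi eta : V) : Prop :=
  exists x p : nat -> V,
    [/\ hamiltonian_trajectory tau x p,
        (x tau, p tau) = (xi, (- eta)%R)
      & subdiff g (x T) (- p T)%R].

Definition primal_qualification : Prop :=
  exists x : nat -> V,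
    rel_interior (edom g) (x T) /\
    forall t, (1 <= t <= T)%N ->
      rel_interior (dom_X t) (x t.-1) /\
      rel_interior (Gamma_L t (x t.-1)) (Delta x t).

Definition dual_qualification : Prop :=
  exists p : nat -> V,
    rel_interior (edom dual_f) (p T) /\
    forall t, (1 <= t <= T)%N ->
      rel_interior (dom_P t) (p t.-1) /\
      rel_interior (Gamma_K t (p t.-1)) (Delta p t).

End bolza.

(* Main.v *)
(* Perturbing the dynamics x_t = x_{t-1} + v_t of the Bolza problem yields a
   convex value function on a finite-dimensional space which, under the primal
   qualification, is supported at 0 by an affine function: a convex relation
   balanced around 0 is supported one coordinate at a time, as in the
   Hahn-Banach theorem.  The multipliers form an adjoint arc p with p_tau = -eta.
   In the coordinates (p_{t-1}, Delta p_t) the dual problem is itself a Bolza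
   problem, so the same result under the dual qualification produces an arc x
   whose biconjugate cost is at most the primal value; by Fenchel-Moreau, x is
   optimal.  Optimality of both arcs splits into the inclusions
   (Delta p_t, p_t) in the subdifferential of L_t at (x_{t-1}, Delta x_t), which
   are equivalent to the Hamiltonian ones.  For the sufficiency part these
   inclusions are summed and telescoped. *)
Require Import Defs.
From HB Require Import structures.
From mathcomp Require Import all_boot all_order all_algebra.
From mathcomp Require Import all_classical all_reals all_analysis.
From mathcomp Require Import ring lra.

Set Implicit Arguments.
Unset Strict Implicit.
Unset Printing Implicit Defensive.

Import Order.TTheory GRing.Theory Num.Theory.
Import numFieldNormedType.Exports.

Local Open Scope classical_set_scope.
Local Open Scope ring_scope.

(** * Supporting affine functions *)

(** A segment joining a point of [C] over a negative abscissa to one over a positive abscissa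
    crosses the vertical axis at a nonnegative height, so left slopes never exceed right slopes. The
    supremum of the left slopes then separates them; balance guarantees that it is bounded as soon
    as a left point exists. *)
Lemma supporting_slope (R : realType) (C : R -> R -> Prop) :
  (forall x y x' y' s, 0 < s < 1 -> C x y -> C x' y' ->
     C (s * x + (1 - s) * x') (s * y + (1 - s) * y')) ->
  (forall x y, C x y -> exists e, 0 < e /\ exists y', C (- (e * x)) y') ->
  (forall y, C 0 y -> 0 <= y) ->
  exists a, forall x y, C x y -> a * x <= y.
Proof.
move=> Cconv Cbal C0.
have cross x1 y1 x2 y2 : C x1 y1 -> C x2 y2 -> 0 < x1 -> x2 < 0 ->
    y2 / x2 <= y1 / x1.
  move=> C1 C2 x1_gt0 x2_lt0.
  have d_gt0 : 0 < x1 - x2 by lra.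
  have d_neq0 : x1 - x2 != 0 by rewrite gt_eqF.
  (* The weight for which the convex combination has abscissa 0. *)
  set s := - x2 / (x1 - x2).
  have s01 : 0 < s < 1.
    by rewrite /s ltr_pdivrMr // divr_gt0 ?oppr_gt0 //= mul1r; lra.
  have := Cconv _ _ _ _ _ s01 C1 C2.
  have -> : s * x1 + (1 - s) * x2 = 0 by rewrite /s; field.
  move/C0; have -> : s * y1 + (1 - s) * y2 = (x1 * y2 - x2 * y1) / (x1 - x2).
    by rewrite /s; field.
  rewrite pmulr_lge0 ?invr_gt0 // => le_cross.
  rewrite ler_pdivlMr // mulrAC ler_ndivrMr //; lra.
set S := [set z | exists x y, [/\ C x y, x < 0 & z = y / x]].
have [[_ [x2 [y2 [C2 x2_lt0 _]]]]|S0] := pselect (S !=set0).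
  have [e [e_gt0 [y1 C1]]] := Cbal _ _ C2.
  have x1_gt0 : 0 < - (e * x2) by rewrite oppr_gt0 pmulr_rlt0.
  have S_sup : has_sup S.
    split; first by exists (y2 / x2), x2, y2.
    exists (y1 / - (e * x2)) => _ [x [y [Cxy x_lt0 ->]]]; exact: cross C1 Cxy _ _.
  exists (sup S) => x y Cxy; case: (ltgtP x 0) => x0.
  - rewrite -ler_ndivrMr //; apply: ub_le_sup; first by case: S_sup.
    by exists x, y.
  - rewrite -ler_pdivlMr //; apply: ge_sup; first by case: S_sup.
    by move=> _ [x' [y' [C' x'_lt0 ->]]]; apply: cross Cxy C' _ _.
  - by rewrite x0 mulr0; apply: C0; rewrite -x0.
(* With no point on the left, balance forbids points on the right: [C] lies over 0 and the slope 0
   works. *)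
exists 0 => x y Cxy; rewrite mul0r; case: (ltgtP x 0) => x0.
- by case: S0; exists (y / x), x, y.
- have [e [e_gt0 [y' Cy']]] := Cbal _ _ Cxy.
  by case: S0; exists (y' / - (e * x)), (- (e * x)), y'; rewrite oppr_lt0 mulr_gt0.
- by apply: C0; rewrite -x0.
Qed.

(** Induction on the coordinates: the hypotheses pass to the slice [t j = 0], which supplies the
    multipliers of the other coordinates, and the planar case then yields the multiplier of [j]. *)
Lemma supporting_multiplier_seq (R : realType) (I : eqType) (s : seq I) (c : R)
    (G : (I -> R) -> R -> Prop) :
  uniq s ->
  (forall t r t' r' l, 0 < l < 1 -> G t r -> G t' r' ->
     G (fun i => l * t i + (1 - l) * t' i) (l * r + (1 - l) * r')) ->
  (forall t r, G t r -> exists e, 0 < e /\ exists r', G (fun i => - (e * t i)) r') ->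
  (forall t r, G t r -> {in s, forall i, t i = 0} -> c <= r) ->
  exists a : I -> R, forall t r, G t r -> c + \sum_(i <- s) a i * t i <= r.
Proof.
elim: s G => [|j s IH] G.
  by move=> _ _ _ Gc; exists (fun=> 0) => t r /Gc; rewrite big_nil addr0; apply.
move=> /= /andP[js us] Gconv Gbal Gc.
have [||t r [Gtr tj0] ts0|a aP] := IH (fun t r => G t r /\ t j = 0) us.
- move=> t r t' r' l l01 [Gtr tj] [Gtr' tj']; split; first exact: Gconv.
  by rewrite tj tj' !mulr0 addr0.
- move=> t r [Gtr tj]; have [e [e_gt0 [r' Gr']]] := Gbal _ _ Gtr.
  by exists e; split=> //; exists r'; split=> //; rewrite tj mulr0 oppr0.
- apply: Gc Gtr _ => i; rewrite inE => /predU1P[->//|]; exact: ts0.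
(* The image of [G] in the plane: coordinate [j] against what remains of [r] after the level [c] and
   the multipliers already found. *)
pose C x y := exists t r, [/\ G t r, x = t j & y = r - c - \sum_(i <- s) a i * t i].
have [|||b bP] := @supporting_slope R C.
- move=> _ _ _ _ l l01 [t [r [Gtr -> ->]]] [t' [r' [Gtr' -> ->]]].
  exists (fun i => l * t i + (1 - l) * t' i), (l * r + (1 - l) * r').
  split=> //; first exact: Gconv.
  have -> : \sum_(i <- s) a i * (l * t i + (1 - l) * t' i) =
      l * (\sum_(i <- s) a i * t i) + (1 - l) * (\sum_(i <- s) a i * t' i).
    rewrite !mulr_sumr -big_split /=; apply: eq_bigr => i _; ring.
  ring.
- move=> _ _ [t [r [Gtr -> _]]]; have [e [e_gt0 [r' Gr']]] := Gbal _ _ Gtr.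
  exists e; split=> //; eexists; exists (fun i => - (e * t i)), r'; split=> //.
- move=> y [t [r [Gtr tj0 ->]]].
  have := aP t r (conj Gtr (esym tj0)); lra.
exists (fun i => if i == j then b else a i) => t r Gtr.
rewrite big_cons eqxx (_ : \sum_(i <- s) _ = \sum_(i <- s) a i * t i); last first.
  rewrite big_seq [RHS]big_seq; apply: eq_bigr => i si.
  by case: eqP => // ij; move: js; rewrite -ij si.
have : C (t j) (r - c - \sum_(i <- s) a i * t i) by exists t, r.
move/bP; lra.
Qed.

Lemma supporting_multiplier (R : realType) (I : finType) (c : R)
    (G : (I -> R) -> R -> Prop) :
  (forall t r t' r' l, 0 < l < 1 -> G t r -> G t' r' ->
     G (fun i => l * t i + (1 - l) * t' i) (l * r + (1 - l) * r')) ->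
  (forall t r, G t r -> exists e, 0 < e /\ exists r', G (fun i => - (e * t i)) r') ->
  (forall t r, G t r -> (forall i, t i = 0) -> c <= r) ->
  exists a : I -> R, forall t r, G t r -> c + \sum_i a i * t i <= r.
Proof.
move=> Gconv Gbal Gc; apply: supporting_multiplier_seq => //.
- exact: index_enum_uniq.
- move=> t r Gtr t0; apply: Gc Gtr _ => i; apply: t0; exact: mem_index_enum.
Qed.

(** Lower semicontinuity bounds [F] below near a point of its domain, and convexity along segments
    issued from that point makes the bound decrease at most linearly. Near [x0] the level [m] itself
    is a bound; away from [x0] a larger [N] absorbs the gap. The value [F x0] may be infinite. *)
Lemma proper_lsc_growth (R : realType) (E : normedModType R) (F : E -> \bar R)
    (x0 : E) (m : R) :
  proper_fun F -> convex_efun F -> lower_semicontinuous F ->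
  (m%:E < F x0)%E ->
  exists2 N, 0 <= N & forall y, ((m - N * `|y - x0|)%:E <= F y)%E.
Proof.
move=> [[y0 Fy0] Fgt] Fconv Flsc mF.
have near_lb z (b : R) : (b%:E < F z)%E ->
    exists2 d, 0 < d & forall y, `|z - y| < d -> (b%:E < F y)%E.
  move=> /Flsc[U /nbhs_ballP[d /= d_gt0 dU] UF]; exists d => // y zy.
  by apply: UF; apply: dU; rewrite -ball_normE.
have := Fgt y0; move: Fy0; rewrite /edom /=.
case F0 : (F y0) => [f0| |] // _ _.
have [d d_gt0 dF] : exists2 d, 0 < d & forall y, `|y0 - y| < d -> ((f0 - 1)%:E < F y)%E.
  by apply: near_lb; rewrite F0 lte_fin; lra.
have lb y : ((f0 - 1 - 2 / d * `|y - y0|)%:E <= F y)%E.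
  have [y_near|y_far] := ltP `|y - y0| d.
    apply: ltW; apply: le_lt_trans (dF y _); last by rewrite distrC.
    by rewrite lee_fin lerBlDr lerDl mulr_ge0 // divr_ge0 // ltW.
  have ny_gt0 : 0 < `|y - y0| by exact: lt_le_trans y_far.
  (* The point of the segment from [y0] to [y] at distance [d / 2] from [y0], where the local bound
     applies. *)
  set s := d / (2 * `|y - y0|).
  have s01 : 0 < s < 1.
    by rewrite /s divr_gt0 ?mulr_gt0 //= ltr_pdivrMr ?mulr_gt0 //; lra.
  have s_gt0 : 0 < s by case/andP: s01.
  have := Fconv y y0 s s01.
  have := dF (s *: y + (1 - s) *: y0) _.
  have -> : y0 - (s *: y + (1 - s) *: y0) = s *: (y0 - y).
    by rewrite scalerBl scale1r scalerBr opprD opprB addrCA [y0 + _]addrC subrK addrC.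
  rewrite normrZ gtr0_norm // distrC.
  have -> : s * `|y - y0| = d / 2 by rewrite /s; field; rewrite gt_eqF.
  move=> /(_ ltac:(lra)) lt1 le2.
  have := lt_le_trans lt1 le2; rewrite F0.
  have := Fgt y; case: (F y) => [r| |] // _; last by rewrite leey.
  rewrite -!EFinM -EFinD lte_fin lee_fin => lt3.
  have -> : 2 / d * `|y - y0| = 1 / s by rewrite /s; field; rewrite !gt_eqF.
  rewrite -(ler_pM2l s_gt0) mulrBr mulrCA mulfV ?gt_eqF //; lra.
have [e e_gt0 eF] := near_lb _ _ mF.
set K := 2 / d in lb; have K_ge0 : 0 <= K by rewrite /K divr_ge0 // ltW.
(* [M] dominates the gap between [m] and the bound [lb]; at distance at least [e] from [x0], the
   extra slope [M / e] contributes at least [M]. *)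
set M := `|m - f0 + 1| + K * `|x0 - y0|.
have M_ge0 : 0 <= M by rewrite addr_ge0 // mulr_ge0.
have Me_ge0 : 0 <= M / e by rewrite divr_ge0 // ltW.
exists (K + M / e) => [|y]; first exact: addr_ge0.
have [y_near|y_far] := ltP `|x0 - y| e.
  apply/ltW/(le_lt_trans _ (eF y y_near)).
  by rewrite lee_fin lerBlDr lerDl mulr_ge0 // addr_ge0.
apply: le_trans (lb y); rewrite lee_fin mulrDl [`|y - x0|]distrC.
have : M <= M / e * `|x0 - y|.
  by rewrite mulrAC ler_pdivlMr // ler_wpM2l.
have : K * `|y - y0| <= K * `|x0 - y| + K * `|x0 - y0|.
  by rewrite -mulrDr ler_wpM2l // [`|x0 - y|]distrC -[y - y0](subrKA x0) ler_normD.
rewrite /M; have := ler_norm (m - f0 + 1); lra.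
Qed.

(* A minorant of the form m - N |y - x0| is concave and finite, so an affine
   function fits between it and F; the multiplier lemma applies to the
   constraint y = z for the function F y + N |z - x0|. *)
Lemma affine_minorant (R : realType) (E : normedModType R) (I : finType)
    (phi : I -> E -> R) (F : E -> \bar R) (x0 : E) (m : R) :
  (forall i (a b : R) x y, phi i (a *: x + b *: y) = a * phi i x + b * phi i y) ->
  (forall x y, (forall i, phi i x = phi i y) -> x = y) ->
  proper_fun F -> convex_efun F -> lower_semicontinuous F ->
  (m%:E < F x0)%E ->
  exists a : I -> R, forall y,
    ((m + \sum_i a i * (phi i y - phi i x0))%:E <= F y)%E.
Proof.
move=> phiL phi_inj Fprop Fconv Flsc mF.
have [N N_ge0 NF] := proper_lsc_growth Fprop Fconv Flsc mF.
pose G (t : I -> R) r := exists y z b, [/\ (F y <= b%:E)%E,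
  b + N * `|z - x0| <= r & forall i, t i = phi i y - phi i z].
have [|||a aP] := @supporting_multiplier R I m G.
- move=> t r t' r' l l01 [y [z [b [Fy br tyz]]]] [y' [z' [b' [Fy' br' tyz']]]].
  have [l_gt0 l_lt1] := andP l01; have l'_gt0 : 0 < 1 - l by lra.
  exists (l *: y + (1 - l) *: y'), (l *: z + (1 - l) *: z'), (l * b + (1 - l) * b').
  split.
  + apply: le_trans (Fconv _ _ _ l01) _; rewrite [leRHS]EFinD !EFinM.
    by apply: leeD; apply: lee_wpmul2l => //; rewrite lee_fin ltW.
  + have : `|l *: z + (1 - l) *: z' - x0| <= l * `|z - x0| + (1 - l) * `|z' - x0|.
      have nZ k (u : E) : 0 < k -> k * `|u| = `|k *: u|.
        by move=> k_gt0; rewrite normrZ gtr0_norm.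
      rewrite !nZ //; apply: le_trans (ler_normD _ _); rewrite le_eqVlt; apply/predU1P; left.
      congr (`| _ |); rewrite !scalerBr addrACA -opprD -scalerDl.
      by rewrite addrC addrC subrKC scale1r.
    move=> /(ler_wpM2l N_ge0); nra.
  + by move=> i; rewrite !phiL tyz tyz'; ring.
(* Balance comes from reflecting [z] in [y]: the norm term is finite everywhere, so [z] may move
   freely. *)
- move=> t r [y [z [b [Fy _ tyz]]]]; exists 1; split=> //.
  eexists; exists y, (2 *: y + (- 1) *: z), b; split=> // i.
  by rewrite phiL tyz; ring.
- move=> t r [y [z [b [Fy br tyz]]]] t0; move: br.
  have <- : y = z by apply: phi_inj => i; apply/eqP; rewrite -subr_eq0 -tyz t0.
  by have := le_trans (NF y) Fy; rewrite lee_fin; lra.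
exists a => y; case Fy : (F y) => [r| |]; last 2 first.
- by rewrite leey.
- by have := Fprop.2 y; rewrite Fy.
rewrite lee_fin; apply: aP; exists y, x0, r; split=> //.
- by rewrite Fy.
- by rewrite subrr normr0 mulr0 addr0.
Qed.

(** * Bilinearity of the dot product *)

Section dot_product.
Variables (R : realType) (n : nat).
Implicit Types x y z : 'rV[R]_n.

Lemma dotC x y : dot x y = dot y x.
Proof. by apply: eq_bigr => i _; rewrite mulrC. Qed.

Lemma dotDr x y z : dot x (y + z) = dot x y + dot x z.
Proof. by rewrite -big_split; apply: eq_bigr => i _; rewrite mxE mulrDr. Qed.

Lemma dotZr a x y : dot x (a *: y) = a * dot x y.
Proof. by rewrite mulr_sumr; apply: eq_bigr => i _; rewrite mxE mulrCA. Qed.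

Lemma dotNr x y : dot x (- y) = - dot x y.
Proof. by rewrite -scaleN1r dotZr mulN1r. Qed.

Lemma dotBr x y z : dot x (y - z) = dot x y - dot x z.
Proof. by rewrite dotDr dotNr. Qed.

Lemma dotDl x y z : dot (x + y) z = dot x z + dot y z.
Proof. by rewrite dotC dotDr !(dotC z). Qed.

Lemma dotNl x y : dot (- x) y = - dot x y.
Proof. by rewrite dotC dotNr dotC. Qed.

Lemma dotBl x y z : dot (x - y) z = dot x z - dot y z.
Proof. by rewrite dotDl dotNl. Qed.

End dot_product.

(** * Relative interiors *)

Section relative_core.
Variable R : realType.

(* For convex sets in finite dimension this is the relative interior. *)
Definition relative_core (E : lmodType R) (D : set E) : set E :=
  [set x | D x /\ forall y, D y ->
    exists2 e, 0 < e & forall k, 0 < k <= e -> D (x - k *: (y - x))].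

(** Moving from [x] away from [y] stays on the line through two points of [S], hence in the affine
    hull, and a short move stays in the neighbourhood of [x]. *)
Lemma rel_interior_core n (S : set 'rV[R]_n) :
  rel_interior S `<=` relative_core S.
Proof.
move=> x [Sx /nbhs_ballP[d /= d_gt0 dS]]; split=> // y Sy.
have d'_gt0 : 0 < `|y - x| + 1 by rewrite ltr_wpDl.
exists (d / 2 / (`|y - x| + 1)) => [|k /andP[k_gt0]]; first by rewrite !divr_gt0.
rewrite ler_pdivlMr // => kd; apply: dS.
  rewrite -ball_normE /= opprB addrC subrK normrZ gtr0_norm //; nra.
move=> M [Maff SM]; rewrite (_ : _ - _ = (1 + k) *: x + (1 - (1 + k)) *: y).
  by apply: Maff; exact: SM.
by apply/rowP => i; rewrite !mxE; ring.
Qed.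

Definition convex_subset (E : lmodType R) (D : set E) :=
  forall (x y : E) (s : R), 0 < s < 1 -> D x -> D y -> D (s *: x + (1 - s) *: y).

Lemma edom_convex (E : lmodType R) (F : E -> \bar R) :
  convex_efun F -> convex_subset (edom F).
Proof.
move=> Fconv x y s s01; rewrite /edom /= => Fx Fy.
apply: le_lt_trans (Fconv _ _ _ s01) _; have [s_gt0 s_lt1] := andP s01.
by apply: lte_add_pinfty; apply: lte_mul_pinfty => //; rewrite lee_fin; lra.
Qed.

(** To move from [(x0, v0)] away from [(x, v)], first go past [x0] in the projection, reaching some
    [v']. The segment from [(x, v)] to this point meets the fibre over [x0]; going past [v0] inside
    that fibre and averaging with [v'] gives the required point. *)
Lemma relative_core_fibre n (D : set ('rV[R]_n * 'rV[R]_n)%type) x0 v0 :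
  convex_subset D ->
  relative_core [set x | exists v, D (x, v)] x0 ->
  relative_core [set v | D (x0, v)] v0 ->
  relative_core D (x0, v0).
Proof.
move=> Dconv [_ Xcore] [/= D0 Vcore]; split=> // -[x v] Dxv.
have [e e_gt0 /(_ e)] : exists2 e, 0 < e & forall k, 0 < k <= e ->
    exists v, D (x0 - k *: (x - x0), v) by apply: Xcore; exists v.
rewrite e_gt0 lexx => /(_ isT)[v' Dv'].
(* The weight that brings the first component back to [x0]. *)
set s := e / (1 + e).
have s01 : 0 < s < 1.
  by rewrite /s divr_gt0 ?addr_gt0 //= ltr_pdivrMr ?addr_gt0 //; lra.
have e1_neq0 : 1 + e != 0 by rewrite gt_eqF // addr_gt0.
have := Dconv _ _ _ s01 Dxv Dv'; set w := _ + _ => Dw.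
have w1 : w.1 = x0 by apply/rowP => i; rewrite !mxE /s; field.
have [|d d_gt0 /(_ d)] := Vcore w.2; first by rewrite /= -w1 -surjective_pairing.
rewrite d_gt0 lexx => /(_ isT) /= Dd.
(* The weight [l] is chosen so that [v'] cancels and only [(x, v)] and [(x0, v0)] remain. *)
set m := d / (1 + e); have m_gt0 : 0 < m by rewrite divr_gt0 // addr_gt0.
set l := m / (1 + m).
have l01 : 0 < l < 1.
  by rewrite /l divr_gt0 ?addr_gt0 //= ltr_pdivrMr ?addr_gt0 //; lra.
have dem_neq0 : 1 + e + d != 0 by rewrite gt_eqF // !addr_gt0.
have := Dconv _ _ _ l01 Dv' Dd.
rewrite (_ : _ + _ = (x0, v0) - (l * e) *: ((x, v) - (x0, v0))); last first.
  congr pair; apply/rowP => i; rewrite !mxE /l /m ?/s; field.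
  + by rewrite e1_neq0.
  + by rewrite e1_neq0.
move=> De; have [l_gt0 _] := andP l01.
have le_gt0 : 0 < l * e by rewrite mulr_gt0.
(* Smaller steps follow by convexity with [(x0, v0)]. *)
exists (l * e) => // k /andP[k_gt0]; rewrite le_eqVlt => /predU1P[->//|k_lt].
have k01 : 0 < k / (l * e) < 1 by rewrite divr_gt0 //= ltr_pdivrMr // mul1r.
have := Dconv _ _ _ k01 De D0.
congr D; congr pair; apply/rowP => i; rewrite !mxE; field.
- by rewrite !gt_eqF.
- by rewrite !gt_eqF.
Qed.

End relative_core.

(** * Strong duality for Bolza problems *)

Lemma common_radius (R : realType) (P : nat -> R -> Prop) (m T : nat) :
  (forall t, (m < t <= T)%N -> exists2 e, 0 < e & forall k, 0 < k <= e -> P t k) ->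
  exists2 e, 0 < e & forall t, (m < t <= T)%N -> forall k, 0 < k <= e -> P t k.
Proof.
elim: T => [_|T IH Ph].
  by exists 1 => // t /andP[]; rewrite leqn0 => mt /eqP t0; rewrite t0 in mt.
have [t /andP[mt tT]|e e_gt0 eP] := IH; first by apply: Ph; rewrite mt leqW.
have [mT|mT] := ltnP m T.+1; last first.
  by exists e => // t /andP[mt tT]; have := leq_trans mt (leq_trans tT mT); rewrite ltnn.
have [|e' e'_gt0 e'P] := Ph T.+1; first by rewrite mT leqnn.
exists (Num.min e e') => [|t /andP[mt]]; first by rewrite lt_min e_gt0.
rewrite leq_eqVlt => /predU1P[->|tT] k /andP[k_gt0]; rewrite le_min => /andP[ke ke'].
  by apply: e'P; rewrite k_gt0.
by apply: eP; rewrite ?mt // k_gt0.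
Qed.

Section bolza_multiplier.
Variables (R : realType) (n T : nat).
Local Notation V := 'rV[R]_n.
Variables (L : nat -> V * V -> \bar R) (g : V -> \bar R).
Hypothesis Lgt : forall t, (1 <= t <= T)%N -> forall z, (-oo < L t z)%E.
Hypothesis Lconv : forall t, (1 <= t <= T)%N -> convex_efun (L t).
Hypothesis ggt : forall x, (-oo < g x)%E.
Hypothesis gconv : convex_efun g.

(** Since [L t] never equals [-oo], [Gamma_L] and [dom_X] are the fibres and the projection of its
    effective domain, so the fibre criterion applies. *)
Lemma primal_qualification_core :
  primal_qualification T L g ->
  exists x : nat -> V, relative_core (edom g) (x T) /\
    forall t, (1 <= t <= T)%N -> relative_core (edom (L t)) (x t.-1, Delta x t).
Proof.
move=> [x [xT xt]]; exists x; split=> [|t tT]; first exact: rel_interior_core.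
have [/rel_interior_core xX /rel_interior_core xG] := xt t tT.
have GE y : Gamma_L L t y = [set v | edom (L t) (y, v)].
  by apply/funext => v; rewrite /Gamma_L /edom /= fin_numElt (Lgt tT) propeqE; split.
apply: relative_core_fibre; first exact/edom_convex/Lconv.
- suff -> : [set y | exists v, edom (L t) (y, v)] = dom_X L t by [].
  by apply/seteqP; split=> y [v]; [|rewrite GE]; exists v; rewrite ?GE.
- by rewrite -GE.
Qed.

(* Strong duality, with the dynamics [x t = x t.-1 + v t] relaxed: the value is
   perturbed by the defects [x t - x t.-1 - v t], whose multipliers are [- p t]. *)
Lemma bolza_multiplier (tau : nat) (eta : V) (c : R) :
  (tau < T)%N ->
  primal_qualification T L g ->
  (forall (x : nat -> V) (l : nat -> R) r,
     (forall t, (tau < t <= T)%N -> L t (x t.-1, Delta x t) <= (l t)%:E)%E ->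
     (g (x T) <= r%:E)%E ->
     c <= \sum_(tau.+1 <= t < T.+1) l t + r - dot eta (x tau)) ->
  exists p : nat -> V, p tau = - eta /\
    forall (y v : nat -> V) b (l : nat -> R) r,
      (forall t, (tau < t <= T)%N -> L t (y t, v t) <= (l t)%:E)%E ->
      (g b <= r%:E)%E ->
      c <= \sum_(tau.+1 <= t < T.+1)
             (l t - (dot (Delta p t) (y t) + dot (p t) (v t))) + (r + dot (p T) b).
Proof.
move=> tauT /primal_qualification_core[xb [xbT xbt]] cP.
have tau1 t : (tau < t <= T)%N -> (1 <= t <= T)%N.
  by move=> /andP[/(leq_ltn_trans (leq0n _)) -> ->].
(* Coordinates with time at most [tau] carry no constraint and are set to 0. The initial state
   [y tau] is free and is charged [- dot eta (y tau)]. *)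
pose G (z : 'I_T.+1 * 'I_n -> R) (r : R) :=
  exists (y v : nat -> V) (l : nat -> R) (b : R),
  [/\ (forall t, (tau < t <= T)%N -> L t (y t.-1, v t) <= (l t)%:E)%E,
      (g (y T) <= b%:E)%E,
      r = \sum_(tau.+1 <= t < T.+1) l t + b - dot eta (y tau) &
      forall k, z k = (tau < k.1)%:R * (y k.1 - y k.1.-1 - v k.1) 0 k.2].
have [|||a aP] := @supporting_multiplier R _ c G.
- move=> z r z' r' s s01 [y [v [l [b [lL bg -> zE]]]]]
    [y' [v' [l' [b' [lL' bg' -> zE']]]]].
  have [s_gt0 s_lt1] := andP s01; have s'_gt0 : 0 < 1 - s by lra.
  exists (fun t => s *: y t + (1 - s) *: y' t), (fun t => s *: v t + (1 - s) *: v' t).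
  exists (fun t => s * l t + (1 - s) * l' t), (s * b + (1 - s) * b'); split.
  + move=> t tT; apply: le_trans (Lconv (tau1 _ tT) (y t.-1, v t) (y' t.-1, v' t) s01) _.
    rewrite [leRHS]EFinD !EFinM; apply: leeD; apply: lee_wpmul2l => //.
    * by rewrite lee_fin ltW.
    * exact: lL.
    * by rewrite lee_fin ltW.
    * exact: lL'.
  + apply: le_trans (gconv _ _ s01) _; rewrite [leRHS]EFinD !EFinM.
    by apply: leeD; apply: lee_wpmul2l => //; rewrite lee_fin ltW.
  + rewrite big_split /= -!mulr_sumr dotDr !dotZr; ring.
  + by move=> k; rewrite zE zE' !mxE; ring.
(* The qualifying arc has zero defect, so moving from it by [- e] times the deviation of [(y, v)]
   multiplies the defect by [- e]; the relative cores keep all costs finite for a common [e]. *)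
- move=> z r [y [v [l [b [lL bg _ zE]]]]].
  have [e1 e1_gt0 gE] : exists2 e, 0 < e & forall k, 0 < k <= e ->
      edom g (xb T - k *: (y T - xb T)).
    by apply: xbT.2; apply: le_lt_trans bg _; rewrite ltry.
  have [|e2 e2_gt0 LE] := @common_radius R (fun t k => edom (L t)
      ((xb t.-1, Delta xb t) - k *: ((y t.-1, v t) - (xb t.-1, Delta xb t)))) tau T.
    move=> t tT; apply: (xbt _ (tau1 _ tT)).2.
    by apply: le_lt_trans (lL _ tT) _; rewrite ltry.
  set e := Num.min e1 e2.
  have e_gt0 : 0 < e by rewrite lt_min e1_gt0.
  have e_le1 : 0 < e <= e1 by rewrite e_gt0 ge_min lexx.
  have e_le2 : 0 < e <= e2 by rewrite e_gt0 ge_min lexx orbT.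
  exists e; split=> //; eexists.
  pose y' t := xb t - e *: (y t - xb t).
  pose v' t := Delta xb t - e *: (v t - Delta xb t).
  have Lfin t : (tau < t <= T)%N -> L t (y' t.-1, v' t) \is a fin_num.
    by move=> tT; rewrite fin_numElt (Lgt (tau1 _ tT)); exact: LE.
  have gfin : g (y' T) \is a fin_num by rewrite fin_numElt ggt; exact: gE.
  exists y', v', (fun t => fine (L t (y' t.-1, v' t))), (fine (g (y' T))); split=> //.
  + by move=> t tT; rewrite fineK // Lfin.
  + by rewrite fineK.
  + by move=> k; rewrite zE /Delta !mxE; ring.
- move=> z r [y [v [l [b [lL bg -> zE]]]]] z0; apply: cP => // t tT.
  suff -> : Delta y t = v t by exact: lL.
  apply/rowP => i; have [tau_t t_le_T] := andP tT; have tT' : (t < T.+1)%N by [].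
 
  have := z0 (Ordinal tT', i); rewrite zE /= tau_t mul1r /Delta !mxE.
  by move/eqP; rewrite subr_eq0 => /eqP.
pose p t : V := if t == tau then - eta else - \row_i a (inord t, i).
exists p; split=> [|y v b l r lL rg]; first by rewrite /p eqxx.
(* Index shift: the state paired with stage [t] is the one at time [t.-1], and the endpoint [b]
   takes the place at time [T]. *)
pose Y t := if t == T then b else y t.+1.
have Yp t : (tau < t <= T)%N -> Y t.-1 = y t.
  move=> /andP[]; case: t => // t _ tT; rewrite /Y /=.
  by rewrite (ltn_eqF tT).
have YT : Y T = b by rewrite /Y eqxx.
have /aP : G (fun k => (tau < k.1)%:R * (Y k.1 - Y k.1.-1 - v k.1) 0 k.2)
    (\sum_(tau.+1 <= t < T.+1) l t + r - dot eta (Y tau)).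
  by exists Y, v, l, r; split=> //; rewrite ?YT // => t tT; rewrite Yp ?lL.
have -> : \sum_k a k * ((tau < k.1)%:R * (Y k.1 - Y k.1.-1 - v k.1) 0 k.2) =
    - \sum_(tau.+1 <= t < T.+1) dot (p t) (Y t - Y t.-1 - v t).
  rewrite -sumrN big_geq_mkord [RHS]big_mkcond /=.
  transitivity (\sum_(t < T.+1) \sum_(i < n)
      a (t, i) * ((tau < t)%:R * (Y t - Y t.-1 - v t) 0 i)).
    by rewrite pair_bigA; apply: eq_bigr => -[t i].
  apply: eq_bigr => t _ /=; case: ltnP => [tau_t|_]; last first.
    by rewrite big1 // => i _; rewrite mul0r mulr0.
  rewrite /p gtn_eqF // dotNl opprK.
  by apply: eq_bigr => i _; rewrite mul1r mxE inord_val.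
(* Summation by parts: the terminal pairing becomes a sum of increments, after which states are
   paired with [Delta p] only; the choice [p tau = - eta] produces the initial term. *)
have -> : r + dot (p T) b = \sum_(tau.+1 <= t < T.+1)
    (dot (p t) (Y t) - dot (p t.-1) (Y t.-1)) + (r - dot eta (Y tau)).
  have := @telescope_sumr _ tau T (fun t => dot (p t) (Y t)) (ltnW tauT).
  rewrite -(@big_add1 _ _ _ tau T.+1 xpredT (fun t => dot (p t) (Y t) - dot (p t.-1) (Y t.-1))).
  by move=> ->; rewrite YT /p eqxx dotNl; ring.
rewrite lerBlDr => cS; rewrite addrA -big_split /=.
have -> : \sum_(tau.+1 <= t < T.+1) (l t - (dot (Delta p t) (y t) + dot (p t) (v t))
      + (dot (p t) (Y t) - dot (p t.-1) (Y t.-1))) =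
    \sum_(tau.+1 <= t < T.+1) l t +
    \sum_(tau.+1 <= t < T.+1) dot (p t) (Y t - Y t.-1 - v t).
  rewrite -big_split; apply: eq_big_nat => t tT /=.
  rewrite Yp // /Delta !(dotBl, dotBr); ring.
by apply: le_trans cS _; rewrite le_eqVlt; apply/predU1P; left; ring.
Qed.

End bolza_multiplier.

(** * Extended-real sums and suprema compared through real bounds *)

Section extended_real_bounds.
Variable R : realType.
Local Open Scope ereal_scope.
Implicit Types A B : \bar R.

Lemma le_of_lt_EFin A B : (forall m : R, m%:E < A -> m%:E <= B) -> A <= B.
Proof.
case: A => [a| |] AB; last by rewrite leNye.
- apply/lee_addgt0Pr => e e_gt0; rewrite -leeBlDr // -EFinB; apply: AB.
  by rewrite lte_fin ltrBlDr ltrDl.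
- case: B AB => [b /(_ (b + 1)%R)| |/(_ 0%R)] //; rewrite ltry => /(_ isT) //.
  by rewrite lee_fin gerDl ler10.
Qed.

Lemma ltNy_EFin A : -oo < A -> exists m : R, m%:E < A.
Proof.
case: A => [a| |] // _; last by exists 0%R; rewrite ltry.
by exists (a - 1)%R; rewrite lte_fin ltrBlDr ltrDl.
Qed.

Lemma ltNy_esum (I : eqType) (s : seq I) (A : I -> \bar R) :
  {in s, forall i, -oo < A i} -> -oo < \sum_(i <- s) A i.
Proof.
move=> AN; rewrite big_seq; elim/big_ind: _ => // x y.
by rewrite !ltNye adde_eq_ninfty negb_or => -> ->.
Qed.

(** Either some term is [+oo] and the sum is too, or the values themselves are admissible real
    majorants. *)
Lemma le_esumD_majorants (I : eqType) (s : seq I) (A : I -> \bar R) B (c : R) :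
  {in s, forall i, -oo < A i} -> -oo < B ->
  (forall (l : I -> R) r, {in s, forall i, A i <= (l i)%:E} -> B <= r%:E ->
    (c <= \sum_(i <- s) l i + r)%R) ->
  c%:E <= \sum_(i <- s) A i + B.
Proof.
move=> AN BN cP; have sN := ltNy_esum AN.
case sB : (_ + _) => [x| |]; last 2 first.
- by rewrite leey.
- by move/eqP: sB; rewrite adde_eq_ninfty => /orP[] /eqP x0; move: sN BN; rewrite x0.
have : \sum_(i <- s) A i + B \is a fin_num by rewrite sB.
rewrite fin_numD => /andP[/sum_fin_numP Afin Bfin].
rewrite -sB -(fineK Bfin) big_seq (eq_bigr (fun i => (fine (A i))%:E)); last first.
  by move=> i si; rewrite fineK // Afin.
rewrite sumEFin -EFinD -big_seq lee_fin; apply: cP; last by rewrite fineK.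
by move=> i si; rewrite fineK // Afin.
Qed.

(** One real minorant of [A] already forces [B] to be finite; [B] can then be moved across and [A]
    approached from below. *)
Lemma leD_minorants A B (c : R) : -oo < A -> -oo < B ->
  (forall a : R, a%:E < A -> B <= (c - a)%:E) -> A + B <= c%:E.
Proof.
move=> AN BN AB; have [m /AB Bm] := ltNy_EFin AN.
have Bfin : B \is a fin_num by rewrite fin_numElt BN (le_lt_trans Bm) ?ltry.
rewrite -(fineK Bfin) -leeBrDr // -EFinB; apply: le_of_lt_EFin => a /AB.
by rewrite -{1}(fineK Bfin) !lee_fin; lra.
Qed.

(** Terms may be [+oo] a priori; they are peeled off one at a time, each replaced by an arbitrary
    real strictly below it. *)
Lemma esumD_minorants_le (I : eqType) (s : seq I) (A : I -> \bar R) B (c : R) :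
  uniq s -> {in s, forall i, -oo < A i} -> -oo < B ->
  (forall (l : I -> R) r, {in s, forall i, (l i)%:E < A i} -> r%:E < B ->
    (\sum_(i <- s) l i + r <= c)%R) ->
  \sum_(i <- s) A i + B <= c%:E.
Proof.
elim: s c => [|j s IH] c.
  move=> _ _ _ Bc; rewrite big_nil add0e; apply: le_of_lt_EFin => m mB.
  by have := Bc (fun=> 0%R) m; rewrite big_nil add0r lee_fin; apply.
move=> /= /andP[js us] AN BN Ac; rewrite big_cons -addeA.
have AsN : {in s, forall i, -oo < A i} by move=> i si; apply: AN; rewrite inE si orbT.
apply: leD_minorants; first by apply: AN; rewrite mem_head.
  by rewrite ltNye adde_eq_ninfty negb_or -!ltNye ltNy_esum.
move=> a aA; apply: IH => // l r lA rB.
have sl : (\sum_(i <- s) (if i == j then a else l i) = \sum_(i <- s) l i)%R.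
  rewrite big_seq [RHS]big_seq; apply: eq_bigr => i si.
  by case: eqP => // ij; move: js; rewrite -ij si.
have := Ac (fun i => if i == j then a else l i) r _ rB.
rewrite big_cons eqxx sl => Acl.
suff : (a + \sum_(i <- s) l i + r <= c)%R by lra.
by apply: Acl => i; rewrite inE; case: eqP => [-> //|_ /= si]; exact: lA.
Qed.

(** Handles [dual_K] and [dual_f] together. An index with [b i = +oo] contributes [-oo] to the
    supremum, and one index with finite [b i] keeps it above [-oo]. *)
Lemma sup_affine_convex (E : lmodType R) (I : Type) (a : I -> E -> R)
    (b : I -> \bar R) (F : E -> \bar R) :
  (forall i x y s, a i (s *: x + (1 - s) *: y)%R = (s * a i x + (1 - s) * a i y)%R) ->
  (forall i, -oo < b i) -> (exists i, b i < +oo) ->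
  (forall x, F x = ereal_sup (range (fun i => (a i x)%:E - b i))) ->
  (forall x, -oo < F x) /\ convex_efun F.
Proof.
move=> aL bN [i0 bi0] FE.
have leF i x : (a i x)%:E - b i <= F x by rewrite FE; apply: ereal_sup_ubound; exists i.
have FN x : -oo < F x.
  apply: lt_le_trans (leF i0 x).
  have : b i0 \is a fin_num by rewrite fin_numElt bN.
  by move=> /fineK <-; rewrite -EFinB ltNyr.
split=> // x y s /andP[s_gt0 s_lt1]; rewrite (FE (_ + _)%R).
apply: ge_ereal_sup => _ [i _ <-].
case bi : (b i) => [r| |]; last 2 first.
- by rewrite leNye.
- by have := bN i; rewrite bi.
rewrite aL (_ : _ - _ = s%:E * ((a i x)%:E - b i) + (1 - s)%:E * ((a i y)%:E - b i)).
  by apply: leeD; apply: lee_wpmul2l => //; rewrite lee_fin; lra.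
by rewrite bi -!EFinB -!EFinM -EFinD; congr EFin; ring.
Qed.

End extended_real_bounds.

(** * Hamiltonian inclusions *)

Section hamiltonian_subgradients.
Variables (R : realType) (n : nat).
Local Notation V := 'rV[R]_n.
Local Open Scope ereal_scope.

Lemma affine_minorant_row (F : V -> \bar R) (x0 : V) (m : R) :
  proper_fun F -> convex_efun F -> lower_semicontinuous F -> m%:E < F x0 ->
  exists a : V, forall y, (m + dot a (y - x0)%R)%:E <= F y.
Proof.
move=> Fprop Fconv Flsc mF.
have [||a aP] := @affine_minorant R V 'I_n (fun i x => x ord0 i) F x0 m _ _ Fprop Fconv Flsc mF.
- by move=> i a b x y; rewrite !mxE.
- by move=> x y xy; apply/rowP.
exists (\row_i a i)%R => y; apply: le_trans (aP y); rewrite lee_fin lerD2l.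
rewrite le_eqVlt; apply/predU1P; left; apply: eq_bigr => i _.
by rewrite !mxE.
Qed.

Lemma affine_minorant_pair (F : V * V -> \bar R) (x0 v0 : V) (m : R) :
  proper_fun F -> convex_efun F -> lower_semicontinuous F -> m%:E < F (x0, v0) ->
  exists q : V * V, forall x v,
    (m + (dot q.1 (x - x0)%R + dot q.2 (v - v0)%R))%:E <= F (x, v).
Proof.
move=> Fprop Fconv Flsc mF.
pose phi (i : 'I_n + 'I_n) (z : V * V) : R :=
  match i with inl j => z.1 ord0 j | inr j => z.2 ord0 j end.
have [||a aP] := @affine_minorant R (V * V)%type _ phi F (x0, v0) m _ _ Fprop Fconv Flsc mF.
- by move=> [i|i] a b x y; rewrite /phi !mxE.
- move=> [x v] [x' v'] xy; congr pair; apply/rowP => i.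
  + exact: (xy (inl i)).
  + exact: (xy (inr i)).
exists (\row_i a (inl i), \row_i a (inr i))%R => x v; apply: le_trans (aP (x, v)).
rewrite lee_fin lerD2l big_sumType /= le_eqVlt; apply/predU1P; left.
by congr +%R; apply: eq_bigr => i _; rewrite !mxE.
Qed.

Variables (L : nat -> V * V -> \bar R) (t : nat).
Local Notation H := (hamiltonian L t).

Lemma hamiltonian_ge x p v : (dot p v)%:E - L t (x, v) <= H x p.
Proof. by apply: ereal_sup_ubound; exists v. Qed.

Hypothesis Lprop : proper_fun (L t).
Hypothesis Lconv : convex_efun (L t).
Hypothesis Llsc : lower_semicontinuous (L t).

Lemma hamiltonian_le x p (c : R) :
  (forall v, (dot p v - c)%:E <= L t (x, v)) -> H x p <= c%:E.
Proof.
move=> cL; apply: ge_ereal_sup => _ [v _ <-]; have := cL v.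
case: (L t (x, v)) => [l| |] //=; last by rewrite leNye.
by rewrite -EFinB !lee_fin; lra.
Qed.

Lemma lsc_section x : lower_semicontinuous (fun v => L t (x, v)).
Proof.
move=> v a /Llsc[U Uxv UL]; exists [set u | U (x, u)] => [|u]; last exact: UL.
move: Uxv => /nbhs_ballP[e e_gt0 eU]; apply/nbhs_ballP; exists e => // u vu.
by apply: eU; split=> //; exact: ballxx.
Qed.

Lemma convex_section x : convex_efun (fun v => L t (x, v)).
Proof.
move=> u v s s01; have := Lconv (x, u) (x, v) s01; congr (L t _ <= _).
by congr pair; rewrite /= -scalerDl addrC subrK scale1r.
Qed.

(** The inequality in the second variable forces equality in Fenchel-Young for the section of [L t]
    at [x], by Fenchel-Moreau through affine minorants. The inequality in the first variable then
    extends the subgradient to both variables. *)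
Lemma cc_subdiff_hamiltonian x p w v :
  cc_subdiff H x p (- w, v)%R ->
  L t (x, v) \is a fin_num /\
  forall z u, L t (x, v) + (dot w (z - x)%R + dot p (u - v)%R)%:E <= L t (z, u).
Proof.
rewrite /cc_subdiff /= opprK => Hsub.
have [[[z0 u0] Lz0] LN] := Lprop.
(* Any point of the domain of [L t] gives a finite lower bound, carried to [x] by the concave
   inequality. *)
have Hx_gtN : -oo < H x p.
  apply: lt_le_trans (Hsub z0 p).1; rewrite ltNye adde_eq_ninfty negb_or /= andbT -ltNye.
  apply: lt_le_trans (hamiltonian_ge z0 p u0).
  have : L t (z0, u0) \is a fin_num by rewrite fin_numElt LN.
  by move=> /fineK <-; rewrite -EFinB ltNyr.
have [_ [u1 _ <-] Lu1] := ereal_sup_gt Hx_gtN.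
have Lxprop : proper_fun (fun v => L t (x, v)).
  split=> //; exists u1; rewrite /edom /= ltey; apply/eqP => Lu1E.
  by move: Lu1; rewrite Lu1E.
(* A minorant of slope [a] with value [m] at [v] bounds [H x a] by [dot a v - m]; the convex
   inequality, evaluated at [a], turns this into a bound on [H x p]. *)
have key m : m%:E < L t (x, v) -> H x p <= (dot p v - m)%:E.
  move=> /(affine_minorant_row Lxprop (@convex_section x) (@lsc_section x))[a aP].
  apply: le_trans (Hsub x a).2 _. rewrite -leeBrDr // -EFinB.
  apply: hamiltonian_le => u; apply: le_trans (aP u).
  by rewrite lee_fin !dotBr !(dotC v); lra.
have [m0 /key Hle] := ltNy_EFin (LN (x, v)).
have Hfin : H x p \is a fin_num by rewrite fin_numElt Hx_gtN (le_lt_trans Hle) ?ltry.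
set h := fine (H x p); have HE : H x p = h%:E by rewrite fineK.
have Lle : L t (x, v) <= (dot p v - h)%:E.
  by apply: le_of_lt_EFin => m /key; rewrite HE !lee_fin; lra.
have Lfin : L t (x, v) \is a fin_num by rewrite fin_numElt LN (le_lt_trans Lle) ?ltry.
split=> // z u; case Lzu : (L t (z, u)) => [r| |]; last 2 first.
- by rewrite leey.
- by have := LN (z, u); rewrite Lzu.
have := le_trans (leeD2r _ (hamiltonian_ge z p u)) (Hsub z p).1.
move: Lle; rewrite HE Lzu -(fineK Lfin) -EFinB -!EFinD !lee_fin !dotBr; lra.
Qed.

(** The subgradient inequality bounds [H z p] above, while testing the supremum at [v] bounds
    [H x q] below; at [(x, p)] the two bounds agree. *)
Lemma hamiltonian_cc_subdiff x p w v :
  L t (x, v) \is a fin_num ->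
  (forall z u, L t (x, v) + (dot w (z - x)%R + dot p (u - v)%R)%:E <= L t (z, u)) ->
  cc_subdiff H x p (- w, v)%R.
Proof.
move=> Lfin Lsub; rewrite /cc_subdiff /= opprK.
set l := fine (L t (x, v)); have LE : L t (x, v) = l%:E by rewrite fineK.
have Hge q : (dot q v - l)%:E <= H x q.
  by have := hamiltonian_ge x q v; rewrite LE -EFinB.
have Hle z : H z p <= (dot p v - l - dot w (z - x)%R)%:E.
  apply: hamiltonian_le => u; apply: le_trans (Lsub z u).
  by rewrite LE -EFinD lee_fin !dotBr; lra.
move=> z q; split.
  apply: le_trans (Hge p); rewrite -leeBrDr // -EFinB; exact: Hle.
apply: le_trans (leeD2r _ (Hge q)); apply: le_trans (Hle x) _.
rewrite -EFinD lee_fin subrr dotBr !(dotC v) (_ : dot w 0 = 0)%R; first by lra.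
by rewrite -(subrr x) dotBr subrr.
Qed.

End hamiltonian_subgradients.

(** * Optimality *)

Section bolza_duality.
Variables (R : realType) (n T : nat).
Local Notation V := 'rV[R]_n.
Variables (L : nat -> V * V -> \bar R) (g : V -> \bar R).

(** Discrete product rule: each summand is the increment of [dot (p t) (z t)]. *)
Lemma bolza_telescope (p z : nat -> V) (tau : nat) : (tau <= T)%N ->
  \sum_(tau.+1 <= t < T.+1) (dot (Delta p t) (z t.-1) + dot (p t) (Delta z t)) =
  dot (p T) (z T) - dot (p tau) (z tau).
Proof.
move=> tauT; rewrite -(telescope_sumr (fun t => dot (p t) (z t)) tauT) big_add1 /=.
by apply: eq_bigr => t _; rewrite /Delta /= !(dotBl, dotBr); ring.
Qed.

Lemma primal_value_le (tau : nat) (x : nat -> V) (l : nat -> R) r :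
  (forall t, (tau < t <= T)%N -> L t (x t.-1, Delta x t) <= (l t)%:E)%E ->
  (g (x T) <= r%:E)%E ->
  (primal_value T L g tau (x tau) <= (\sum_(tau.+1 <= t < T.+1) l t + r)%:E)%E.
Proof.
move=> lL rg; apply: le_trans (_ : (\sum_(tau.+1 <= t < T.+1) L t (x t.-1, Delta x t) +
  g (x T))%E <= _)%E; first by apply: ereal_inf_lbound; exists x.
rewrite EFinD; apply: leeD => //; rewrite -sumEFin big_seq [leRHS]big_seq.
by apply: lee_sum => t; rewrite mem_index_iota; exact: lL.
Qed.

Hypothesis Lprop : forall t, (1 <= t <= T)%N -> proper_fun (L t).
Hypothesis gprop : proper_fun g.

Let tau1 tau t : (tau < t <= T)%N -> (1 <= t <= T)%N.
Proof. by move=> /andP[/(leq_ltn_trans (leq0n _)) -> ->]. Qed.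

Lemma le_primal_value (tau : nat) (xi : V) (c : R) :
  (forall (x : nat -> V) (l : nat -> R) r, x tau = xi ->
    (forall t, (tau < t <= T)%N -> L t (x t.-1, Delta x t) <= (l t)%:E)%E ->
    (g (x T) <= r%:E)%E -> c <= \sum_(tau.+1 <= t < T.+1) l t + r) ->
  (c%:E <= primal_value T L g tau xi)%E.
Proof.
move=> cP; apply: le_ereal_inf_tmp => _ [x /= x_tau <-].
apply: le_esumD_majorants => [t||l r lL rg].
- by rewrite mem_index_iota => /tau1/Lprop[].
- exact: gprop.2.
- by apply: cP rg => // t tT; apply: lL; rewrite mem_index_iota.
Qed.

Lemma trajectory_subdiff_primal_value (tau : nat) (xi eta : V) :
  (forall t, (1 <= t <= T)%N -> convex_efun (L t)) ->
  (forall t, (1 <= t <= T)%N -> lower_semicontinuous (L t)) ->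
  (tau < T)%N ->
  transversal_trajectory_exists T L g tau xi eta ->
  subdiff (primal_value T L g tau) xi eta.
Proof.
move=> Lconv Llsc tauT [x [p [traj [x_tau p_tau] [gxT gsub]]]].
have sub t (tT : (tau < t <= T)%N) := cc_subdiff_hamiltonian (Lprop (tau1 tT))
  (Lconv t (tau1 tT)) (Llsc t (tau1 tT)) (traj t tT).
have gfin : g (x T) \is a fin_num by rewrite fin_numElt gprop.2.
pose l t := fine (L t (x t.-1, Delta x t)).
have lE t : (tau < t <= T)%N -> L t (x t.-1, Delta x t) = (l t)%:E.
  by move=> tT; rewrite fineK // (sub t tT).1.
have le_val : (primal_value T L g tau xi <=
    (\sum_(tau.+1 <= t < T.+1) l t + fine (g (x T)))%:E)%E.
  by rewrite -x_tau; apply: primal_value_le => [t /lE->|] //; rewrite fineK.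
split=> [|z]; first by apply: le_lt_trans le_val _; rewrite ltry.
apply: le_trans (leeD2r _ le_val) _; rewrite -EFinD.
apply: le_primal_value => y l' r y_tau lL rg.
have le_l : \sum_(tau.+1 <= t < T.+1) (l t + (dot (Delta p t) (y t.-1 - x t.-1) +
    dot (p t) (Delta y t - Delta x t))) <= \sum_(tau.+1 <= t < T.+1) l' t.
  apply: ler_sum_nat => t tT; rewrite -lee_fin; apply: le_trans (lL t tT).
  by rewrite EFinD -lE //; exact: (sub t tT).2.
have le_r : fine (g (x T)) + dot (- p T) (y T - x T) <= r.
  by rewrite -lee_fin EFinD fineK //; exact: le_trans (gsub _) rg.
(* Telescoping along [y - x] leaves two boundary terms: the one at [T] cancels with transversality,
   the one at [tau] is the subgradient term in [eta]. *)
have := bolza_telescope p (fun t => y t - x t) (ltnW tauT).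
rewrite (eq_bigr (fun t => dot (Delta p t) (y t.-1 - x t.-1) +
    dot (p t) (Delta y t - Delta x t))); last first.
  by move=> t _; congr (_ + dot _ _); apply/rowP => i; rewrite /Delta !mxE; ring.
move=> tele; move: le_l le_r; rewrite big_split /= tele x_tau y_tau p_tau !dotNl; lra.
Qed.

(** Fenchel-Young at every stage and at the endpoint, followed by summation by parts. *)
Lemma weak_duality (tau : nat) (x p : nat -> V) (l k : nat -> R) r s :
  (tau <= T)%N ->
  (forall t, (tau < t <= T)%N -> L t (x t.-1, Delta x t) <= (l t)%:E)%E ->
  (g (x T) <= r%:E)%E ->
  (forall t, (tau < t <= T)%N -> dual_K L t (p t.-1 + Delta p t, Delta p t)%R <= (k t)%:E)%E ->
  (dual_f g (p T) <= s%:E)%E ->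
  0 <= \sum_(tau.+1 <= t < T.+1) l t + r + (\sum_(tau.+1 <= t < T.+1) k t + s) +
    dot (p tau) (x tau).
Proof.
move=> tauT lL rg kK sf.
have FY (a b d : R) (B K : \bar R) :
    (a%:E - B <= K)%E -> (K <= b%:E)%E -> (B <= d%:E)%E -> a <= b + d.
  move=> /le_trans aK /aK aB Bd; rewrite -lee_fin EFinD -leeBlDr //.
  by apply: le_trans aB; apply: leeB.
have : \sum_(tau.+1 <= t < T.+1) (dot (Delta p t) (x t.-1) + dot (p t) (Delta x t)) <=
    \sum_(tau.+1 <= t < T.+1) (k t + l t).
  apply: ler_sum_nat => t tT; apply: FY (kK t tT) (lL t tT).
  apply: ereal_sup_ubound; exists (x t.-1, Delta x t) => //=.
  rewrite (_ : p t.-1 + Delta p t = p t); last by rewrite /Delta addrC subrK.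
  by rewrite (dotC (x _)) (dotC (Delta x t)).
rewrite bolza_telescope // big_split /=.
have : dot (x T) (- p T) <= s + r.
  by apply: FY sf rg; apply: ereal_sup_ubound; exists (x T).
rewrite dotNr (dotC (x T)); lra.
Qed.

End bolza_duality.

(** * Attainment and the converse under the qualification conditions *)

Section optimal_trajectory.
Variables (R : realType) (n T : nat).
Local Notation V := 'rV[R]_n.
Variables (L : nat -> V * V -> \bar R) (g : V -> \bar R).
Hypothesis Lprop : forall t, (1 <= t <= T)%N -> proper_fun (L t).
Hypothesis Lconv : forall t, (1 <= t <= T)%N -> convex_efun (L t).
Hypothesis Llsc : forall t, (1 <= t <= T)%N -> lower_semicontinuous (L t).
Hypothesis gprop : proper_fun g.
Hypothesis gconv : convex_efun g.
Hypothesis glsc : lower_semicontinuous g.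
Variables (tau : nat).
Hypothesis tauT : (tau < T)%N.

Let tau1 t : (tau < t <= T)%N -> (1 <= t <= T)%N.
Proof. by move=> /andP[/(leq_ltn_trans (leq0n _)) -> ->]. Qed.

(* In the coordinates (p t.-1, Delta p t) the dual problem is again a Bolza
   problem, and its qualification condition is the primal one for this cost. *)
Let K t (q : V * V) := dual_K L t ((q.1 + q.2)%R, q.2).

Lemma dual_cost_convex t : (1 <= t <= T)%N ->
  (forall q, -oo < K t q)%E /\ convex_efun (K t).
Proof.
move=> tT; have [[z0 Lz0] LN] := Lprop tT.
apply: (@sup_affine_convex R (V * V)%type (V * V)%type
  (fun z q => dot z.1 q.2 + dot z.2 (q.1 + q.2)) (fun z => L t (z.1, z.2))).
- by move=> z x y s; rewrite /= !(dotDr, dotZr); ring.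
- by move=> z; exact: LN.
- by exists z0; rewrite -surjective_pairing.
- by [].
Qed.

Lemma dual_f_convex : (forall b, -oo < dual_f g b)%E /\ convex_efun (dual_f g).
Proof.
have [[y0 gy0] gN] := gprop.
apply: (@sup_affine_convex R V V (fun y b => dot y (- b)) g) => //.
- by move=> z x y s; rewrite !(dotNr, dotDr, dotZr); ring.
- by exists y0.
Qed.

(** The arc of the dual qualification has finite dual cost, so weak duality bounds the primal value
    below by a real number. *)
Lemma primal_value_gtNy xi :
  dual_qualification T L g -> (-oo < primal_value T L g tau xi)%E.
Proof.
move=> [p [[pT _] pt]].
have [fN _] := dual_f_convex.
have ffin : dual_f g (p T) \is a fin_num by rewrite fin_numElt fN.
have Kfin t : (tau < t <= T)%N ->
    dual_K L t (p t.-1 + Delta p t, Delta p t) \is a fin_num.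
  by move=> /tau1 /pt[_ []].
apply: lt_le_trans (le_primal_value (c := - (\sum_(tau.+1 <= t < T.+1)
  fine (dual_K L t (p t.-1 + Delta p t, Delta p t)%R) + fine (dual_f g (p T))) -
  dot (p tau) xi) Lprop gprop _); first by rewrite ltNyr.
move=> x l r x_tau lL rg.
have := @weak_duality R n T L g tau x p l (fun t => fine (dual_K L t
  (p t.-1 + Delta p t, Delta p t))) r (fine (dual_f g (p T))) (ltnW tauT) lL rg.
rewrite x_tau => /(_ _ _)/le_trans h.
suff : 0 <= \sum_(tau.+1 <= t < T.+1) l t + r +
   (\sum_(tau.+1 <= t < T.+1) fine (dual_K L t (p t.-1 + Delta p t, Delta p t)) +
   fine (dual_f g (p T))) + dot (p tau) xi by lra.
by apply: h => // [t tT|]; rewrite fineK // Kfin.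
Qed.

(** The multipliers of the dual Bolza problem form the arc [x]; testing their inequality at slopes
    of affine minorants of [L t] and [g] recovers the primal cost of [x]. *)
Lemma primal_attainment (xi : V) (theta : R) :
  dual_qualification T L g ->
  (primal_value T L g tau xi = theta%:E) ->
  exists x : nat -> V, x tau = xi /\
    (\sum_(tau.+1 <= t < T.+1) L t (x t.-1, Delta x t) + g (x T) <= theta%:E)%E.
Proof.
move=> dq valE; have [fN fconv] := dual_f_convex.
(* With [- xi] for [eta] and [- theta] for [c], the required lower bound is weak duality, and the
   multiplier arc starts at [xi]. *)
have [||||p k s kK sf|x [x_tau xP]] := @bolza_multiplier R n T K (dual_f g)
    _ _ _ _ tau (- xi) (- theta) tauT dq.
- by move=> t /dual_cost_convex[].
- by move=> t /dual_cost_convex[].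
- by [].
- by [].
- have : ((- (\sum_(tau.+1 <= t < T.+1) k t + s) - dot (p tau) xi)%:E <=
      primal_value T L g tau xi)%E.
    apply: le_primal_value => // y l r y_tau lL rg.
    by have := weak_duality (ltnW tauT) lL rg kK sf; rewrite y_tau; lra.
  by rewrite valE lee_fin dotNl (dotC xi); lra.
rewrite opprK in x_tau; exists x; split=> //.
have mem t : (t \in index_iota tau.+1 T.+1) = (tau < t <= T)%N by rewrite mem_index_iota.
apply: esumD_minorants_le => [|t||l r lL rg].
- exact: iota_uniq.
- by rewrite mem => /tau1/Lprop[].
- exact: gprop.2.
have /choice[q qP] : forall t, exists q : V * V, (tau < t <= T)%N ->
    forall z u, ((l t + (dot q.1 (z - x t.-1) + dot q.2 (u - Delta x t)))%:E <= L t (z, u))%E.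
  move=> t; have [tT|] := boolP (tau < t <= T)%N; last by exists (0, 0).
  have /lL lLt : t \in index_iota tau.+1 T.+1 by rewrite mem.
  have [q qP] := affine_minorant_pair (Lprop (tau1 tT)) (Lconv (tau1 tT))
    (Llsc (tau1 tT)) lLt.
  by exists q => _.
have [a aP] := affine_minorant_row gprop gconv glsc rg.
(* The slope [q t] reads as [(Delta p t, p t)], which is [((q t).2 - (q t).1, (q t).1)] in the
   coordinates of [K]. *)
have Kle t : (tau < t <= T)%N -> (K t ((q t).2 - (q t).1, (q t).1)%R <=
    (dot (q t).1 (x t.-1) + dot (q t).2 (Delta x t) - l t)%:E)%E.
  move=> tT; apply: ge_ereal_sup => _ [[z u] _ <-] /=; rewrite subrK.
  have := qP t tT z u; have := (Lprop (tau1 tT)).2 (z, u).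
  case: (L t (z, u)) => [b| |] //= _; last by rewrite leNye.
  by rewrite -EFinB !lee_fin !dotBr !(dotC z) !(dotC u); lra.
have fle : (dual_f g (- a) <= (dot a (x T) - r)%:E)%E.
  apply: ge_ereal_sup => _ [y _ <-]; rewrite opprK.
  have := aP y; have := gprop.2 y.
  case: (g y) => [b| |] //= _; last by rewrite leNye.
  by rewrite -EFinB !lee_fin dotBr (dotC y); lra.
have := xP _ _ _ _ _ Kle fle.
rewrite (eq_bigr (fun t => - l t)); last first.
  move=> t _; rewrite dotBr !(dotC (Delta x t)) {1}/Delta dotBr (dotC (x t)).
  by rewrite /Delta !dotBr; ring.
by rewrite sumrN dotNr (dotC (x T)); lra.
Qed.

Lemma subdiff_primal_value_trajectory (xi eta : V) :
  primal_qualification T L g -> dual_qualification T L g ->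
  subdiff (primal_value T L g tau) xi eta ->
  transversal_trajectory_exists T L g tau xi eta.
Proof.
move=> pq dq [val_lty val_sub].
have val_fin : primal_value T L g tau xi \is a fin_num.
  by rewrite fin_numElt primal_value_gtNy.
set theta := fine (primal_value T L g tau xi).
have valE : primal_value T L g tau xi = theta%:E by rewrite fineK.
have [x [x_tau x_opt]] := primal_attainment dq valE.
(* The subgradient inequality for the value function says that the cost minus [dot eta (y tau)] is
   at least [theta - dot eta xi] on every arc. *)
have [||||y l r lL rg|p [p_tau pP]] := @bolza_multiplier R n T L g
    _ _ _ _ tau eta (theta - dot eta xi) tauT pq.
- by move=> t /Lprop[].
- exact: Lconv.
- exact: gprop.2.
- exact: gconv.
- have := le_trans (val_sub (y tau)) (primal_value_le lL rg).
  by rewrite valE -EFinD lee_fin dotBr; lra.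
have mem t : (t \in index_iota tau.+1 T.+1) = (tau < t <= T)%N by rewrite mem_index_iota.
have LN t : (tau < t <= T)%N -> (-oo < L t (x t.-1, Delta x t))%E.
  by move=> /tau1/Lprop[].
have : (\sum_(tau.+1 <= t < T.+1) L t (x t.-1, Delta x t) + g (x T) \is a fin_num)%E.
  rewrite fin_numElt (le_lt_trans x_opt) ?ltry // andbT.
  rewrite ltNye adde_eq_ninfty negb_or -!ltNye gprop.2 andbT.
  by apply: ltNy_esum => t; rewrite mem; exact: LN.
rewrite fin_numD => /andP[/sum_fin_numP Lfin gfin].
pose l t := fine (L t (x t.-1, Delta x t)).
have lE t : (tau < t <= T)%N -> L t (x t.-1, Delta x t) = (l t)%:E.
  by move=> tT; rewrite fineK // Lfin ?mem.
set r := fine (g (x T)); have rE : g (x T) = r%:E by rewrite fineK.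
have opt : \sum_(tau.+1 <= t < T.+1) l t + r <= theta.
  move: x_opt; rewrite rE big_seq (eq_bigr (fun t => (l t)%:E)) => [|t]; last first.
    by rewrite mem; exact: lE.
  by rewrite -big_seq sumEFin -EFinD lee_fin.
have tele := bolza_telescope p x (ltnW tauT).
rewrite x_tau p_tau dotNl in tele.
exists x, p; split.
- move=> t0 tT0; apply: hamiltonian_cc_subdiff => [|z u]; first by rewrite lE.
  have := (Lprop (tau1 tT0)).2 (z, u).
  case Lzu : (L t0 (z, u)) => [b| |] // _; last by rewrite leey.
  rewrite lE // -EFinD lee_fin.
  (* The multiplier inequality does not couple the stages, so the optimal arc may be altered at
     stage [t0] alone; the other stages cancel by optimality. *)
  have := pP (fun t => if t == t0 then z else x t.-1)
    (fun t => if t == t0 then u else Delta x t) (x T)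
    (fun t => if t == t0 then b else l t) r.
  rewrite rE lexx => /(_ _ isT).
  have t0_mem : t0 \in index_iota tau.+1 T.+1 by rewrite mem.
  rewrite (bigD1_seq t0 t0_mem (iota_uniq _ _)) /= !eqxx.
  rewrite (eq_bigr (fun t => l t - (dot (Delta p t) (x t.-1) + dot (p t) (Delta x t)))); last first.
    by move=> t /negPf ->.
  rewrite sumrB => h; move: tele opt.
  rewrite !(bigD1_seq t0 t0_mem (iota_uniq _ _)) /= => tele opt.
  have /h : forall t, (tau < t <= T)%N -> (L t (if t == t0 then z else x t.-1,
      if t == t0 then u else Delta x t) <= (if t == t0 then b else l t)%:E)%E.
    by move=> t tT; case: eqP => [->|_]; rewrite ?Lzu ?lE.
  rewrite (dotBr _ z) (dotBr _ u); lra.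
- by rewrite x_tau p_tau.
- split=> [|y]; first by rewrite /edom /= rE ltry.
  have := gprop.2 y; case gy : (g y) => [b| |] // _; last by rewrite leey.
  rewrite rE -EFinD lee_fin.
  (* Only the endpoint is altered here, which gives transversality. *)
  have := pP (fun t => x t.-1) (fun t => Delta x t) y l b.
  rewrite gy lexx => /(_ _ isT) h.
  have /h : forall t, (tau < t <= T)%N -> (L t (x t.-1, Delta x t) <= (l t)%:E)%E.
    by move=> t /lE ->.
  by rewrite sumrB tele dotNl dotBr; lra.
Qed.

End optimal_trajectory.

Theorem theorem3p2 (R : realType) (T n : nat) (hT : (1 <= T)%N) (hn : (1 <= n)%N)
    (L : nat -> 'rV[R]_n * 'rV[R]_n -> \bar R) (g : 'rV[R]_n -> \bar R)
    (hLproper : forall t, (1 <= t <= T)%N -> proper_fun (L t))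
    (hLconvex : forall t, (1 <= t <= T)%N -> convex_efun (L t))
    (hLlsc : forall t, (1 <= t <= T)%N -> lower_semicontinuous (L t))
    (hgproper : proper_fun g)
    (hgconvex : convex_efun g)
    (hglsc : lower_semicontinuous g)
    (tau : nat) (htau : (tau < T)%N) (xi eta : 'rV[R]_n) :
  (transversal_trajectory_exists T L g tau xi eta ->
     subdiff (primal_value T L g tau) xi eta) /\
  (primal_qualification T L g -> dual_qualification T L g ->
     subdiff (primal_value T L g tau) xi eta ->
     transversal_trajectory_exists T L g tau xi eta).
Proof.
split; first exact: trajectory_subdiff_primal_value.
exact: subdiff_primal_value_trajectory.
Qed.
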